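(* The $(n-1)$-dimensional measure of the intersection of a minimal graph over the unit $n$-ball with a hyperplane is not uniformly bounded. Specifically, given any constant $c$, there is some function $u$ satisfying $$\operatorname{div}\bigg(\frac{\nabla u}{\sqrt{1+|\nabla u|^2}}\bigg)=0\quad\text{in }\mathbb{B}^n$$ for which $\Sigma_u$ and $\Pi$ intersect transversally but $$\mathcal{H}^{n-1}(\Sigma_u\cap\Pi)>c.$$
   Context: $\mathbb{B}^n$ is the unit ball of $\mathbb{R}^n$. For a function $u$ on $\mathbb{B}^n$, $\Sigma_u:=\{(x,u(x)):x\in\mathbb{B}^n\}\subset\mathbb{R}^{n+1}$ is its graph; it is a minimal hypersurface of $\mathbb{R}^{n+1}$ (a minimal graph over the unit $n$-ball) exactly when $u$ satisfies the displayed equation. $\Pi:=\{x\in\mathbb{R}^{n+1}: x_{n+1}=0,\ |x|<1\}$ is the portion of the horizontal hyperplane contained in the unit ball of $\mathbb{R}^{n+1}$. $\mathcal{H}^{n-1}$ denotes $(n-1)$-dimensional Hausdorff measure.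
   Formalization: The statement is given for n ≥ 2: for n = 1 the solutions are affine, so a transversal intersection with the hyperplane has at most one point and its measure cannot exceed c = 1. *)

(* Defs.v *)
From HB Require Import structures.
From mathcomp Require Import all_boot all_order all_algebra.
From mathcomp Require Import all_classical all_reals all_analysis.

Set Implicit Arguments.
Unset Strict Implicit.
Unset Printing Implicit Defensive.

Import Order.TTheory GRing.Theory Num.Theory.
Import numFieldNormedType.Exports.

Local Open Scope classical_set_scope.
Local Open Scope ring_scope.

(* R^n is 'rV[R]_n. The library norm `|x| on 'rV[R]_n is the sup norm (it only
   serves here for the topology and the derivatives), so the Euclidean norm is
   defined separately. *)
Definition enorm (R : realType) (n : nat) (x : 'rV[R]_n) : R :=
  Num.sqrt (\sum_(i < n) x ord0 i ^+ 2).

Definition unit_ball (R : realType) (n : nat) : set 'rV[R]_n :=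
  [set x | enorm x < 1].
Arguments unit_ball R n : clear implicits.

Definition partial (R : realType) (n : nat) (i : 'I_n) (f : 'rV[R]_n -> R) :
    'rV[R]_n -> R :=
  fun x => 'D_(delta_mx ord0 i) f x.

(* f is C^k on U, for an open set U *)
Fixpoint Ck (R : realType) (n k : nat) (U : set 'rV[R]_n)
    (f : 'rV[R]_n -> R) {struct k} : Prop :=
  (forall x, U x -> {for x, continuous f}) /\
  (if k is k'.+1 then
     forall i : 'I_n,
       (forall x, U x -> derivable f x (delta_mx ord0 i)) /\
       Ck k' U (partial i f)
   else True).

Definition grad (R : realType) (n : nat) (f : 'rV[R]_n -> R)
    (x : 'rV[R]_n) : 'rV[R]_n :=
  \row_(i < n) partial i f x.

Definition divergence (R : realType) (n : nat) (F : 'rV[R]_n -> 'rV[R]_n)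
    (x : 'rV[R]_n) : R :=
  \sum_(i < n) partial i (fun y => F y ord0 i) x.

(* Classical (C^2) solutions of the minimal surface equation in the unit ball;
   the values of u outside the ball are irrelevant. *)
Definition minimal_surface_solution (R : realType) (n : nat)
    (u : 'rV[R]_n -> R) : Prop :=
  Ck 2 (unit_ball R n) u /\
  forall x, unit_ball R n x ->
    divergence
      (fun y => (Num.sqrt (1 + enorm (grad u y) ^+ 2))^-1 *: grad u y) x = 0.

Definition graph_ball (R : realType) (n : nat) (u : 'rV[R]_n -> R) :
    set 'rV[R]_(n + 1) :=
  [set row_mx x (u x)%:M | x in unit_ball R n].

(* rsubmx p is the last coordinate of p *)
Definition horizontal_disk (R : realType) (n : nat) : set 'rV[R]_(n + 1) :=
  [set p | rsubmx p = 0 /\ unit_ball R (n + 1) p].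
Arguments horizontal_disk R n : clear implicits.

(* Velocities at p of curves in M through p. When M is an embedded C^1
   submanifold, these vectors form the tangent space T_p M. *)
Definition tangent_vector (R : realType) (m : nat) (M : set 'rV[R]_m)
    (p v : 'rV[R]_m) : Prop :=
  exists gamma : R -> 'rV[R]_m,
    [/\ gamma 0 = p,
        \forall t \near (0 : R), M (gamma t) &
        is_derive (0 : R) 1 gamma v].

(* T_p M + T_p N is the whole space at every common point p *)
Definition transverse (R : realType) (m : nat) (M N : set 'rV[R]_m) : Prop :=
  forall p, M p -> N p ->
  forall w : 'rV[R]_m, exists v1 v2 : 'rV[R]_m,
    [/\ tangent_vector M p v1, tangent_vector N p v2 & w = v1 + v2].

(* Volume of the unit ball of R^m, i.e. pi^(m/2) / Gamma(m/2 + 1), through the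
   recurrence omega_(m+2) = 2 pi / (m + 2) * omega_m. *)
Fixpoint omega (R : realType) (m : nat) {struct m} : R :=
  match m with
  | 0%N => 1
  | 1%N => 2
  | (k.+1 as j).+1 => 2 * pi / (j.+1)%:R * omega R k
  end.

(* -oo on the empty set, which is excluded from the sums below *)
Definition diam (R : realType) (m : nat) (U : set 'rV[R]_m) : \bar R :=
  ereal_sup [set z | exists x y, [/\ U x, U y & z = (enorm (x - y))%:E]].

Definition hausdorff_content (R : realType) (m s : nat) (delta : R)
    (A : set 'rV[R]_m) : \bar R :=
  ereal_inf [set z | exists U : nat -> set 'rV[R]_m,
    [/\ A `<=` \bigcup_k U k,
        forall k, (diam (U k) <= delta%:E)%E &
        z = (\sum_(0 <= k <oo | U k != set0)
               (omega R s / 2 ^+ s)%:E * diam (U k) ^+ s)%E]].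

(* The s-dimensional Hausdorff (outer) measure for an integer s, normalised to
   agree with Lebesgue measure on R^s. The content is nonincreasing in delta,
   so its limit as delta -> 0+ is a supremum. *)
Definition hausdorff (R : realType) (m s : nat) (A : set 'rV[R]_m) : \bar R :=
  ereal_sup [set hausdorff_content s delta A | delta in [set d : R | 0 < d]].

(* Main.v *)
Require Import Defs.
From HB Require Import structures.
From mathcomp Require Import all_boot all_order all_algebra.
From mathcomp Require Import all_classical all_reals all_analysis.
From mathcomp Require Import ring lra zify.
Import Order.TTheory GRing.Theory Num.Theory.
Import numFieldNormedType.Exports.
Local Open Scope classical_set_scope.
Local Open Scope ring_scope.
Set Implicit Arguments.
Unset Strict Implicit.
Unset Printing Implicit Defensive.

(** Scherk's singly periodic surface sinh u * sinh y = sin x is the graph of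
    u = arsinh (sin x / sinh y) over the half-plane y > 0, and it is minimal.
    Along each half-line x = k pi, y > 0, the function u vanishes and its
    derivative in x does not. So the surface crosses the horizontal plane
    transversally along infinitely many parallel half-lines. Shrinking it by a
    factor l puts these lines at distance pi / l from each other, and moving it
    in the y direction puts the half-plane around the unit disk. The number of
    zero lines that cross a fixed square then grows like l. In dimension n the
    function u is taken to depend on the first and the last coordinate only, so
    that the zero lines become slices of hyperplanes orthogonal to the first
    axis. The proof has three parts.

    The equation. With X, Y the rescaled variables, D = sinh^2 Y + sin^2 X and
    Q = sqrt D, the gradient of u is (cos X / Q, - sin X cosh Y / (sinh Y Q)),
    and 1 + |grad u|^2 collapses to coth^2 Y. The flux
    grad u / sqrt (1 + |grad u|^2) is therefore
    (sinh Y cos X / (cosh Y Q), - sin X / Q), and the two terms of its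
    divergence are opposite to each other: both are equal, up to the sign, to
    l sin X sinh Y cosh Y / Q^3 ([scherk_minimal]). Smoothness comes from the
    fact that the functions built from coordinates by field operations, sqrt,
    exp, ln, sin and cos are stable under partial derivatives
    ([Ck_elementary]).

    Transversality. At a zero of u some directional derivative of u is nonzero,
    hence the tangent space of the graph contains a vector with any given last
    coordinate, and the rest is horizontal ([transverse_graph]).

    The measure. K parallel (n-1)-dimensional cubes of side a lie in the zero
    set, and their Hausdorff measure is at least a constant (depending on n and
    a) times K, up to an additive constant ([hausdorff_slices_gt]). It is enough
    to bound sum_k d_k^(n-1) from below for a cover by sets of diameter d_k
    smaller than the distance between two cubes. Each set lies in an open ball
    of radius slightly larger than d_k; by compactness finitely many balls are
    enough; and such a ball sees one cube only and contains few points of a fine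
    grid, whereas the grid has K N^(n-1) points ([slices_cover_sum]). As K is
    free while a depends on n only, the measure exceeds any given constant. *)

(** * Differential calculus along lines *)

Lemma derive_line (R : realType) (V : normedModType R) (f : V -> R) (x v : V) :
  'D_v f x = 'D_1 (fun h : R => f (h *: v + x)) 0.
Proof.
rewrite /derive; set g1 := fun h => h^-1 *: _; set g2 := fun h => _ *: _.
suff -> : g1 = g2 by [].
apply/funext => h; rewrite /g1 /g2 /=.
by rewrite addr0 scale0r add0r [_%:A]mulr1.
Qed.

Lemma is_derive_line (R : realType) (V : normedModType R) (f : V -> R)
    (x v : V) (df : R) :
  is_derive x v f df -> is_derive (0 : R) 1 (fun h : R => f (h *: v + x)) df.
Proof.
move=> [fxv <-]; apply: DeriveDef; first exact: (derivable1P _ _ _).1.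
by rewrite -derive_line.
Qed.

(** A directional derivative is an ordinary derivative along a line, which
    reduces the claim to the one-variable chain rule. *)
Lemma is_derive_chain (R : realType) (V : normedModType R) (f : V -> R)
    (phi : R -> R) (x v : V) (df dphi : R) :
  is_derive x v f df -> is_derive (f x) 1 phi dphi ->
  is_derive x v (phi \o f) (dphi * df).
Proof.
move=> /is_derive_line [dg <-]; set g := fun h => _ in dg *; move=> [dphi0 <-].
have g0 : g 0 = f x by rewrite /g scale0r add0r.
rewrite -g0 in dphi0 *; apply: DeriveDef.
  apply/derivable1P/derivable1_diffP; apply: (@differentiable_comp _ _ _ _ g phi).
    exact/derivable1_diffP.
  exact/derivable1_diffP.
by rewrite derive_line -derive1E (@derive1_comp _ g phi) // !derive1E.
Qed.

Lemma is_derive_coord (R : realType) (n : nat) (j : 'I_n) (x v : 'rV[R]_n) :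
  is_derive x v (fun y => y ord0 j) (v ord0 j).
Proof.
apply: DeriveDef; first exact/diff_derivable/differentiable_coord.
rewrite /derive; apply: (@cvg_lim) => //.
apply/cvgrPdist_le => e e0; near=> h; rewrite /= !mxE addrK.
rewrite -[_ *: _]/(_ * _) mulKf ?subrr ?normr0 ?ltW //.
by near: h; exact: nbhs_dnbhs_neq.
Unshelve. all: by end_near. Qed.

Lemma is_derive_inv (R : realType) (V : normedModType R) (g : V -> R)
    (x v : V) (dg : R) :
  g x != 0 -> is_derive x v g dg ->
  is_derive x v (fun y => (g y)^-1) (- (g x) ^- 2 * dg).
Proof.
by move=> gx0 [dgx <-]; apply: DeriveDef; [exact: derivableV|rewrite deriveV].
Qed.

Lemma is_derive_div (R : realType) (V : normedModType R) (f g : V -> R)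
    (x v : V) (df dg : R) :
  g x != 0 -> is_derive x v f df -> is_derive x v g dg ->
  is_derive x v (fun y => f y / g y) ((df * g x - f x * dg) / g x ^+ 2).
Proof.
move=> gx0 dfx dgx.
have dV := is_derive_inv gx0 dgx.
apply: (is_derive_eq (is_deriveM dfx dV)); rewrite -![_ *: _]/(_ * _).
by field.
Qed.

Lemma is_derive_scalel (R : realType) (V W : normedModType R) (f : V -> R)
    (x v : V) (df : R) (w : W) :
  is_derive x v f df -> is_derive x v (fun y => f y *: w) (df *: w).
Proof.
move=> [fxv <-].
have lim : (fun h : R => h^-1 *: (((fun y => f y *: w) \o shift x) (h *: v) - f x *: w))
    @ 0^' --> 'D_v f x *: w.
  rewrite (_ : (fun h : R => _) =
    fun h : R => (h^-1 *: ((f \o shift x) (h *: v) - f x)) *: w); last first.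
    by apply/funext => h; rewrite /= -scalerBl scalerA.
  by apply: cvgZr_tmp; exact: fxv.
by apply: DeriveDef; [apply/cvg_ex; exists ('D_v f x *: w)|exact: cvg_lim lim].
Qed.

(** * Smoothness of elementary functions *)

(** Being of class [Ck] for every [k] is obtained for all these functions at
    once, because the partial derivatives of such a function are again such
    functions. The side conditions keep each operation within the domain where
    it is differentiable; they bear on [U] only. *)
Inductive elementary (R : realType) (n : nat) (U : set 'rV[R]_n) :
    ('rV[R]_n -> R) -> Prop :=
| elementary_cst c : elementary U (fun=> c)
| elementary_coord j : elementary U (fun x => x ord0 j)
| elementaryD f g : elementary U f -> elementary U g ->
    elementary U (fun x => f x + g x)
| elementaryM f g : elementary U f -> elementary U g ->
    elementary U (fun x => f x * g x)
| elementaryV f : (forall x, U x -> f x != 0) -> elementary U f ->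
    elementary U (fun x => (f x)^-1)
| elementary_sqrt f : (forall x, U x -> 0 < f x) -> elementary U f ->
    elementary U (fun x => Num.sqrt (f x))
| elementary_expR f : elementary U f -> elementary U (fun x => expR (f x))
| elementary_ln f : (forall x, U x -> 0 < f x) -> elementary U f ->
    elementary U (fun x => ln (f x))
| elementary_sin f : elementary U f -> elementary U (fun x => sin (f x))
| elementary_cos f : elementary U f -> elementary U (fun x => cos (f x)).

Lemma elementaryN (R : realType) (n : nat) (U : set 'rV[R]_n) f :
  elementary U f -> elementary U (fun x => - f x).
Proof.
move=> ef; rewrite (_ : (fun x => - f x) = (fun x => -1 * f x)).
  by apply: elementaryM => //; exact: elementary_cst.
by apply/funext => x; rewrite mulN1r.
Qed.

Lemma differentiable_elementary (R : realType) (n : nat) (U : set 'rV[R]_n) f :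
  elementary U f -> forall x, U x -> differentiable f x.
Proof.
have chain (h : 'rV[R]_n -> R) (phi : R -> R) x : differentiable h x ->
    derivable phi (h x) 1 -> differentiable (phi \o h) x.
  by move=> ? /derivable1_diffP; apply: differentiable_comp.
elim=> {f} [c|j|f g _ IHf _ IHg|f g _ IHf _ IHg|f f0 _ IH|f f0 _ IH|f _ IH
            |f f0 _ IH|f _ IH|f _ IH] x Ux.
- exact: differentiable_cst.
- exact: differentiable_coord.
- exact: (differentiableD (IHf _ Ux) (IHg _ Ux)).
- exact: (differentiableM (IHf _ Ux) (IHg _ Ux)).
- by apply: differentiableV; [exact: IH|exact: f0].
- apply: (chain f Num.sqrt); first exact: IH.
  by have /is_derive1_sqrt [] := f0 _ Ux.
- by apply: (chain f expR); [exact: IH|exact: derivable_expR].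
- apply: (chain f (@ln R)); first exact: IH.
  by have /is_derive1_ln [] := f0 _ Ux.
- by apply: (chain f (@sin R)); [exact: IH|exact: derivable_sin].
- by apply: (chain f (@cos R)); [exact: IH|exact: derivable_cos].
Qed.

Lemma elementary_derive (R : realType) (n : nat) (U : set 'rV[R]_n) f v :
  elementary U f -> exists2 g, elementary U g &
    forall x, U x -> is_derive x v f (g x).
Proof.
elim=> {f} [c|j|f g ef [f' ef' df] eg [g' eg' dg]|f g ef [f' ef' df] eg [g' eg' dg]
  |f f0 ef [f' ef' df]|f f0 ef [f' ef' df]|f ef [f' ef' df]
  |f f0 ef [f' ef' df]|f ef [f' ef' df]|f ef [f' ef' df]].
- exists (fun=> 0); first exact: elementary_cst.
  by move=> x _; exact: is_derive_cst.
- exists (fun=> v ord0 j); first exact: elementary_cst.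
  by move=> x _; exact: is_derive_coord.
- exists (fun x => f' x + g' x); first exact: elementaryD.
  by move=> x Ux; have ? := df x Ux; have ? := dg x Ux; exact: is_deriveD.
- exists (fun x => f x * g' x + g x * f' x).
    by apply: elementaryD; apply: elementaryM.
  by move=> x Ux; have ? := df x Ux; have ? := dg x Ux; exact: is_deriveM.
- exists (fun x => - (f x * f x)^-1 * f' x).
    apply: elementaryM => //; apply: elementaryN; apply: elementaryV.
      by move=> x Ux; rewrite mulf_neq0 // f0.
    exact: elementaryM.
  by move=> x Ux; apply: is_derive_inv; [exact: f0|exact: df].
- exists (fun x => (2 * Num.sqrt (f x))^-1 * f' x).
    apply: elementaryM => //; apply: elementaryV.
      by move=> x Ux; rewrite mulf_neq0 // sqrtr_eq0 -ltNge f0.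
    by apply: elementaryM; [exact: elementary_cst|exact: elementary_sqrt].
  move=> x Ux; apply: (@is_derive_chain _ _ f Num.sqrt); first exact: df.
  exact/is_derive1_sqrt/f0.
- exists (fun x => expR (f x) * f' x).
    by apply: elementaryM => //; exact: elementary_expR.
  by move=> x Ux; apply: (@is_derive_chain _ _ f expR); exact: df.
- exists (fun x => (f x)^-1 * f' x).
    by apply: elementaryM => //; apply: elementaryV => // x Ux; rewrite gt_eqF ?f0.
  move=> x Ux; apply: (@is_derive_chain _ _ f (@ln R)); first exact: df.
  exact/is_derive1_ln/f0.
- exists (fun x => cos (f x) * f' x).
    by apply: elementaryM => //; exact: elementary_cos.
  by move=> x Ux; apply: (@is_derive_chain _ _ f sin); exact: df.
- exists (fun x => - sin (f x) * f' x).
    by apply: elementaryM => //; apply: elementaryN; exact: elementary_sin.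
  by move=> x Ux; apply: (@is_derive_chain _ _ f (@cos R)); exact: df.
Qed.

Lemma open_eq_near (R : realType) (n : nat) (U : set 'rV[R]_n)
    (f g : 'rV[R]_n -> R) x :
  open U -> (forall y, U y -> f y = g y) -> U x -> {near x, f =1 g}.
Proof.
move=> oU fg Ux; apply: (@filterS _ _ _ U); first exact: fg.
exact: open_nbhs_nbhs.
Qed.

Lemma eq_Ck (R : realType) (n k : nat) (U : set 'rV[R]_n) f g :
  open U -> (forall x, U x -> f x = g x) -> Ck k U f -> Ck k U g.
Proof.
move=> oU.
have cont (f' g' : 'rV[R]_n -> R) x : (forall x, U x -> f' x = g' x) -> U x ->
    {for x, continuous f'} -> {for x, continuous g'}.
  move=> fg Ux; rewrite /prop_for /continuous_at -(fg x Ux) => cf.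
  exact: (cvg_trans (near_eq_cvg (open_eq_near oU fg Ux)) cf).
elim: k f g => [|k IH] f g fg [cf pf].
  by split=> // x Ux; exact: cont fg Ux (cf x Ux).
split=> [x Ux|i]; first exact: cont fg Ux (cf x Ux).
have [df Cf] := pf i; split=> [x Ux|].
  exact: near_eq_derivable (open_eq_near oU fg Ux) (df x Ux).
by apply: IH Cf => x Ux; apply: near_eq_derive; exact: open_eq_near fg Ux.
Qed.

(** Induction on [k]: a partial derivative agrees on the open set [U] with an
    elementary function, and [eq_Ck] transfers regularity along this agreement. *)
Lemma Ck_elementary (R : realType) (n k : nat) (U : set 'rV[R]_n) f :
  open U -> elementary U f -> Ck k U f.
Proof.
have cont h : elementary U h -> forall x, U x -> {for x, continuous h}.
  by move=> ef x Ux; exact/differentiable_continuous/(differentiable_elementary ef).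
move=> oU; elim: k f => [|k IH] f ef; split; [exact: cont|by []|exact: cont|] => i.
split=> [x Ux|]; first exact/diff_derivable/(differentiable_elementary ef).
have [g eg dg] := elementary_derive (delta_mx ord0 i) ef.
apply: (@eq_Ck _ _ _ _ g) => //; last exact: IH.
by move=> x Ux; have [_ <-] := dg x Ux.
Qed.

(** * The Euclidean unit ball *)

Lemma open_unit_ball (R : realType) (n : nat) : open (unit_ball R n).
Proof.
have csq : continuous (fun x : 'rV[R]_n => \sum_(i < n) x ord0 i ^+ 2).
  apply: continuous_big => [|i _ x]; first exact: add_continuous.
  have cx : {for x, continuous (fun y : 'rV[R]_n => y ord0 i)}.
    exact: coord_continuous.
  exact: (continuousM cx cx).
have cnorm : continuous (@enorm R n).
  by move=> x; apply: continuous_comp; [exact: csq|exact: sqrt_continuous].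
rewrite (_ : unit_ball R n = @enorm R n @^-1` [set t | t < 1]) //.
by move/continuousP: cnorm; apply; exact: open_lt.
Qed.

Lemma ler_coord_enorm (R : realType) (n : nat) (x : 'rV[R]_n) i :
  `|x ord0 i| <= enorm x.
Proof.
rewrite -sqrtr_sqr ler_wsqrtr // (bigD1 i) //= lerDl.
by apply: sumr_ge0 => j _; exact: sqr_ge0.
Qed.

Lemma unit_ball_coord (R : realType) (n : nat) (x : 'rV[R]_n) i :
  unit_ball R n x -> -1 < x ord0 i < 1.
Proof. by move=> Ux; rewrite -ltr_norml (le_lt_trans (ler_coord_enorm x i)). Qed.

(** * Hyperbolic functions *)

Definition sinh (R : realType) (y : R) : R := (expR y - expR (- y)) / 2.
Definition cosh (R : realType) (y : R) : R := (expR y + expR (- y)) / 2.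

Lemma cosh2 (R : realType) (y : R) : cosh y ^+ 2 = 1 + sinh y ^+ 2.
Proof.
rewrite /cosh /sinh expRN; have : expR y != 0 by rewrite gt_eqF ?expR_gt0.
by move: (expR y) => a a0; field.
Qed.

Lemma cosh_gt0 (R : realType) (y : R) : 0 < cosh y.
Proof. by rewrite divr_gt0 // addr_gt0 ?expR_gt0. Qed.

Lemma sinh_gt0 (R : realType) (y : R) : 0 < y -> 0 < sinh y.
Proof. by move=> y0; rewrite divr_gt0 // subr_gt0 ltr_expR; lra. Qed.

Lemma is_derive_expRN (R : realType) (y : R) :
  is_derive y 1 (fun t => expR (- t)) (- expR (- y)).
Proof.
have dN : is_derive y 1 (fun t : R => - t) (- 1) by exact: is_deriveNid.
have := @is_derive_chain R R (fun t => - t) expR y 1 _ _ dN (is_derive_expR _).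
by rewrite mulrN1.
Qed.

Lemma is_derive_sinh (R : realType) (y : R) : is_derive y 1 (@sinh R) (cosh y).
Proof.
have dB := is_deriveB (is_derive_expR y) (is_derive_expRN y).
have two0 : cst (2 : R) y != 0 by rewrite pnatr_eq0.
apply: (is_derive_eq (is_derive_div two0 dB (is_derive_cst _ y 1))).
by rewrite /cosh /=; field.
Qed.

Lemma is_derive_cosh (R : realType) (y : R) : is_derive y 1 (@cosh R) (sinh y).
Proof.
have dD := is_deriveD (is_derive_expR y) (is_derive_expRN y).
have two0 : cst (2 : R) y != 0 by rewrite pnatr_eq0.
apply: (is_derive_eq (is_derive_div two0 dD (is_derive_cst _ y 1))).
by rewrite /sinh /=; field.
Qed.

(** * Scherk's surface as a minimal graph *)

Definition scherkX (R : realType) (m : nat) (l : R) (x : 'rV[R]_m.+1) : R :=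
  l * x ord0 ord0.

(** The shift by 2 keeps the unit ball inside the half-space where [sinh]
    is positive. *)
Definition scherkY (R : realType) (m : nat) (l : R) (x : 'rV[R]_m.+1) : R :=
  l * (x ord0 ord_max + 2).

Definition scherkQ (R : realType) (m : nat) (l : R) (x : 'rV[R]_m.+1) : R :=
  Num.sqrt (sinh (scherkY l x) ^+ 2 + sin (scherkX l x) ^+ 2).

(** This is l^-1 * arsinh (sin X / sinh Y), with the logarithm of the quotient
    (sin X + Q) / sinh Y split into a difference. *)
Definition scherk (R : realType) (m : nat) (l : R) (x : 'rV[R]_m.+1) : R :=
  l^-1 * (ln (sin (scherkX l x) + scherkQ l x) - ln (sinh (scherkY l x))).

Lemma is_derive_scherkX (R : realType) m (l : R) (x v : 'rV[R]_m.+1) :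
  is_derive x v (scherkX l) (l * v ord0 ord0).
Proof.
apply: (is_derive_eq (is_deriveM (is_derive_cst l x v) (is_derive_coord ord0 x v))).
by rewrite scaler0 addr0.
Qed.

Lemma is_derive_scherkY (R : realType) m (l : R) (x v : 'rV[R]_m.+1) :
  is_derive x v (scherkY l) (l * v ord0 ord_max).
Proof.
have dD := is_deriveD (is_derive_coord ord_max x v) (is_derive_cst (2 : R) x v).
apply: (is_derive_eq (is_deriveM (is_derive_cst l x v) dD)).
by rewrite scaler0 !addr0.
Qed.

Section ScherkDerivatives.
Context (R : realType) (m : nat) (l : R) (x v : 'rV[R]_m.+1).
Local Notation X := (scherkX l x).
Local Notation Y := (scherkY l x).
Local Notation Q := (scherkQ l x).
Local Notation dX := (l * v ord0 ord0).
Local Notation dY := (l * v ord0 ord_max).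

Lemma is_derive_sinX : is_derive x v (fun y => sin (scherkX l y)) (cos X * dX).
Proof. exact: is_derive_chain (is_derive_scherkX l x v) (is_derive_sin _). Qed.

Lemma is_derive_cosX : is_derive x v (fun y => cos (scherkX l y)) (- sin X * dX).
Proof. exact: is_derive_chain (is_derive_scherkX l x v) (is_derive_cos _). Qed.

Lemma is_derive_sinhY : is_derive x v (fun y => sinh (scherkY l y)) (cosh Y * dY).
Proof. exact: is_derive_chain (is_derive_scherkY l x v) (is_derive_sinh _). Qed.

Lemma is_derive_coshY : is_derive x v (fun y => cosh (scherkY l y)) (sinh Y * dY).
Proof. exact: is_derive_chain (is_derive_scherkY l x v) (is_derive_cosh _). Qed.

Context (Y0 : 0 < Y).

Lemma scherk_radicand_gt0 : 0 < sinh Y ^+ 2 + sin X ^+ 2.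
Proof. by rewrite ltr_pwDl ?sqr_ge0 // exprn_gt0 // sinh_gt0. Qed.

Lemma scherkQ_gt0 : 0 < Q.
Proof. by rewrite sqrtr_gt0 scherk_radicand_gt0. Qed.

Lemma scherkQ2 : Q ^+ 2 = sinh Y ^+ 2 + sin X ^+ 2.
Proof. by rewrite sqr_sqrtr // ltW // scherk_radicand_gt0. Qed.

(** Q^2 exceeds sin^2 X by sinh^2 Y > 0, hence Q > |sin X|. *)
Lemma sinX_addQ_gt0 : 0 < sin X + Q.
Proof.
have Q0 := scherkQ_gt0; have Q2 := scherkQ2; have S0 := sinh_gt0 Y0.
rewrite -ltrBlDl sub0r; case: (leP 0 (- sin X)) => [s0|]; last by move/lt_trans; apply.
by rewrite -(ltr_pXn2r (n := 2)) ?nnegrE ?(ltW Q0) // Q2 sqrrN ltrDr exprn_gt0.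
Qed.

Lemma is_derive_scherkQ :
  is_derive x v (scherkQ l) ((sinh Y * cosh Y * dY + sin X * cos X * dX) / Q).
Proof.
have dD := is_deriveD (is_deriveX 2 is_derive_sinhY) (is_deriveX 2 is_derive_sinX).
apply: (is_derive_eq (is_derive_chain dD (is_derive1_sqrt scherk_radicand_gt0))).
rewrite -/Q -![_ *: _]/(_ * _) /= expr1.
by have := lt0r_neq0 scherkQ_gt0; move: Q => q q0; field.
Qed.

Lemma is_derive_scherk :
  is_derive x v (scherk l)
    (l^-1 * (cos X / Q * dX - sin X * cosh Y / (sinh Y * Q) * dY)).
Proof.
have Q0 := scherkQ_gt0; have Q2 := scherkQ2; have S0 := sinh_gt0 Y0.
have d1 := is_derive_chain (is_deriveD is_derive_sinX is_derive_scherkQ)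
  (is_derive1_ln sinX_addQ_gt0).
have d2 := is_derive_chain is_derive_sinhY (is_derive1_ln S0).
apply: (is_derive_eq (is_deriveM (is_derive_cst l^-1 x v) (is_deriveB d1 d2))).
rewrite scaler0 addr0 /=; congr (_ * _).
move: (lt0r_neq0 Q0) (lt0r_neq0 S0) (lt0r_neq0 sinX_addQ_gt0) => Qn Sn sQn.
field: Q2.
by rewrite ?Qn ?Sn ?sQn.
Qed.

(** The components of grad u / sqrt (1 + |grad u|^2), where u is [scherk l], along
    the first and the last axis; [scherk_flux] is the proof of this. *)
Definition scherk_fluxX (y : 'rV[R]_m.+1) : R :=
  sinh (scherkY l y) * cos (scherkX l y) / (cosh (scherkY l y) * scherkQ l y).
Definition scherk_fluxY (y : 'rV[R]_m.+1) : R := - sin (scherkX l y) / scherkQ l y.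

(** The numerator of the derivative contains Q^2 + cos^2 X, which equals
    cosh^2 Y: this is where the definition of Q enters. *)
Lemma is_derive_scherk_fluxX : v ord0 ord_max = 0 ->
  is_derive x v scherk_fluxX (- (sin X * sinh Y * cosh Y / Q ^+ 3) * dX).
Proof.
move=> vm; have Q0 := lt0r_neq0 scherkQ_gt0; have Q2 := scherkQ2.
have C0 := lt0r_neq0 (cosh_gt0 Y); have C2 := cosh2 Y; have cs := cos2Dsin2 X.
have CQ0 : cosh Y * Q != 0 by rewrite mulf_neq0.
have dn := is_deriveM is_derive_sinhY is_derive_cosX.
have dd := is_deriveM is_derive_coshY is_derive_scherkQ.
apply: (is_derive_eq (@is_derive_div _ _ _
  (fun y => cosh (scherkY l y) * scherkQ l y) _ _ _ _ CQ0 dn dd)).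
rewrite vm mulr0 -![_ *: _]/(_ * _) /= -[(_ * _) x]/(sinh Y * cos X).
have c2 : cos X ^+ 2 = 1 - sin X ^+ 2 by rewrite -cs addrK.
field: Q2 C2 c2.
by rewrite Q0.
Qed.

Lemma is_derive_scherk_fluxY : v ord0 ord0 = 0 ->
  is_derive x v scherk_fluxY (sin X * sinh Y * cosh Y / Q ^+ 3 * dY).
Proof.
move=> v0; have Q0 := lt0r_neq0 scherkQ_gt0.
apply: (is_derive_eq (is_derive_div Q0 (is_deriveN is_derive_sinX) is_derive_scherkQ)).
rewrite v0 mulr0 /= -[(- _) x]/(- sin X).
by field.
Qed.

End ScherkDerivatives.

Lemma scherk_grad (R : realType) (m : nat) (l : R) (x : 'rV[R]_m.+1) i :
  0 < l -> 0 < scherkY l x ->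
  grad (scherk l) x ord0 i =
    cos (scherkX l x) / scherkQ l x * (i == ord0)%:R -
    sin (scherkX l x) * cosh (scherkY l x) / (sinh (scherkY l x) * scherkQ l x)
      * (i == ord_max)%:R.
Proof.
move=> l0 Y0; rewrite mxE /partial.
have [_ ->] := is_derive_scherk (delta_mx ord0 i) Y0.
have ln0 := lt0r_neq0 l0; have Q0 := lt0r_neq0 (scherkQ_gt0 Y0).
have S0 := lt0r_neq0 (sinh_gt0 Y0).
rewrite !mxE !eqxx /= ![_ == i]eq_sym; field.
by rewrite Q0 S0.
Qed.

Lemma ord_max_neq0 (m : nat) : (0 < m)%N -> (ord_max == ord0 :> 'I_m.+1) = false.
Proof. by move=> m0; apply/negbTE; rewrite -val_eqE /= -lt0n. Qed.

Lemma sum_two_coords (R : realType) (m : nat) (F : 'I_m.+1 -> R) (a b : R) :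
  (0 < m)%N -> F ord0 = a -> F ord_max = b ->
  (forall i, i != ord0 -> i != ord_max -> F i = 0) -> \sum_i F i = a + b.
Proof.
move=> m0 Fa Fb F0; rewrite (bigD1 ord0) //= (bigD1 ord_max) ?ord_max_neq0 //=.
by rewrite big1 ?addr0 ?Fa ?Fb // => i /andP[]; exact: F0.
Qed.

(** The surface is special in that 1 + |grad u|^2 is the square of the function
    cosh Y / sinh Y of Y alone, which removes the outer square root. *)
Lemma scherk_flux (R : realType) (m : nat) (l : R) (x : 'rV[R]_m.+1) i :
  (0 < m)%N -> 0 < l -> 0 < scherkY l x ->
  ((Num.sqrt (1 + enorm (grad (scherk l) x) ^+ 2))^-1 *: grad (scherk l) x) ord0 i
  = scherk_fluxX l x * (i == ord0)%:R + scherk_fluxY l x * (i == ord_max)%:R.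
Proof.
move=> m0 l0 Y0.
have Q0 := scherkQ_gt0 Y0; have Q2 := scherkQ2 Y0; have S0 := sinh_gt0 Y0.
have C0 := cosh_gt0 (scherkY l x); have C2 := cosh2 (scherkY l x).
have cs := cos2Dsin2 (scherkX l x).
have neq := ord_max_neq0 m0.
rewrite [LHS]mxE scherk_grad // /enorm sqr_sqrtr; last first.
  by apply: sumr_ge0 => j _; exact: sqr_ge0.
rewrite (sum_two_coords (a := (cos (scherkX l x) / scherkQ l x) ^+ 2)
  (b := (sin (scherkX l x) * cosh (scherkY l x)
         / (sinh (scherkY l x) * scherkQ l x)) ^+ 2)) //; first last.
- by move=> j /negbTE j0 /negbTE jm; rewrite scherk_grad // j0 jm !mulr0 subr0 expr0n.
- by rewrite scherk_grad // neq eqxx mulr0 sub0r mulr1 sqrrN.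
- by rewrite scherk_grad // eq_sym neq eqxx mulr0 subr0 mulr1.
have -> : 1 + ((cos (scherkX l x) / scherkQ l x) ^+ 2 +
    (sin (scherkX l x) * cosh (scherkY l x)
     / (sinh (scherkY l x) * scherkQ l x)) ^+ 2)
  = (cosh (scherkY l x) / sinh (scherkY l x)) ^+ 2.
  have Qn := lt0r_neq0 Q0; have Sn := lt0r_neq0 S0.
  have c2 : cos (scherkX l x) ^+ 2 = 1 - sin (scherkX l x) ^+ 2 by rewrite -cs addrK.
  field: Q2 C2 c2.
  by rewrite Sn.
rewrite sqrtr_sqr gtr0_norm; last exact: divr_gt0.
rewrite /scherk_fluxX /scherk_fluxY.
have Qn := lt0r_neq0 Q0; have Sn := lt0r_neq0 S0; have Cn := lt0r_neq0 C0.
field.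
by rewrite Qn Cn.
Qed.

Lemma scherkY_gt0 (R : realType) (m : nat) (l : R) (x : 'rV[R]_m.+1) :
  0 < l -> unit_ball R m.+1 x -> 0 < scherkY l x.
Proof.
by move=> l0 /(unit_ball_coord ord_max) /andP[xm _]; rewrite mulr_gt0 //; lra.
Qed.

(** Only two terms of the divergence survive, the X derivative of the first
    component of the flux and the Y derivative of the last one, and they cancel. *)
Lemma scherk_minimal (R : realType) (m : nat) (l : R) :
  (0 < m)%N -> 0 < l -> minimal_surface_solution (@scherk R m l).
Proof.
move=> m0 l0; have oU := @open_unit_ball R m.+1.
have Y0 := @scherkY_gt0 R m l _ l0.
have neq := ord_max_neq0 m0.
split.
  apply: Ck_elementary => //.
  have eX : elementary (unit_ball R m.+1) (@scherkX R m l).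
    by apply: elementaryM; [exact: elementary_cst|exact: elementary_coord].
  have eY : elementary (unit_ball R m.+1) (@scherkY R m l).
    apply: elementaryM; first exact: elementary_cst.
    by apply: elementaryD; [exact: elementary_coord|exact: elementary_cst].
  have eS : elementary (unit_ball R m.+1) (fun x => sinh (@scherkY R m l x)).
    apply: elementaryM; last exact: elementary_cst.
    apply: elementaryD; first exact: elementary_expR.
    by apply: elementaryN; apply: elementary_expR; exact: elementaryN.
  have eQ : elementary (unit_ball R m.+1) (@scherkQ R m l).
    apply: elementary_sqrt => [x Ux|]; first exact/scherk_radicand_gt0/Y0.
    by apply: elementaryD; apply: elementaryM => //; exact: elementary_sin.
  apply: elementaryM; first exact: elementary_cst.
  apply: elementaryD.
    apply: elementary_ln => [x Ux|]; first exact/sinX_addQ_gt0/Y0.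
    by apply: elementaryD => //; exact: elementary_sin.
  by apply: elementaryN; apply: elementary_ln => [x Ux|//]; exact/sinh_gt0/Y0.
move=> x Ux; pose F (i : 'I_m.+1) (y : 'rV[R]_m.+1) : R :=
  scherk_fluxX l y * (i == ord0)%:R + scherk_fluxY l y * (i == ord_max)%:R.
(* [scherk_flux] holds on the ball only, which is open: that is enough to replace
   the flux by [F] under the derivative. *)
have part i : partial i (fun y => ((Num.sqrt (1 + enorm (grad (@scherk R m l) y) ^+ 2))^-1
    *: grad (@scherk R m l) y) ord0 i) x = 'D_(delta_mx ord0 i) (F i) x.
  apply: near_eq_derive; apply: (open_eq_near oU _ Ux) => y Uy.
  by rewrite scherk_flux // Y0.
rewrite /divergence (sum_two_coords
  (a := - (sin (scherkX l x) * sinh (scherkY l x) * cosh (scherkY l x)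
        / scherkQ l x ^+ 3) * l)
  (b := sin (scherkX l x) * sinh (scherkY l x) * cosh (scherkY l x)
        / scherkQ l x ^+ 3 * l)) //; first by rewrite mulNr addNr.
- rewrite part (_ : F ord0 = scherk_fluxX l); last first.
    by apply/funext => y; rewrite /F eq_sym neq eqxx mulr0 addr0 mulr1.
  have [|_ ->] := @is_derive_scherk_fluxX R m l x (delta_mx ord0 ord0) (Y0 x Ux).
    by rewrite mxE neq.
  by rewrite mxE !eqxx mulr1.
- rewrite part (_ : F ord_max = scherk_fluxY l); last first.
    by apply/funext => y; rewrite /F neq eqxx mulr0 add0r mulr1.
  have [|_ ->] := @is_derive_scherk_fluxY R m l x (delta_mx ord0 ord_max) (Y0 x Ux).
    by rewrite mxE eq_sym neq.
  by rewrite mxE !eqxx mulr1.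
- move=> i /negbTE i0 /negbTE im; rewrite part (_ : F i = cst 0) ?derive_cst //.
  by apply/funext => y; rewrite /F i0 im !mulr0 addr0.
Qed.

(** * Transversality of a graph and the horizontal plane *)

Lemma near_line (R : realType) (n : nat) (U : set 'rV[R]_n) x v :
  open U -> U x -> \forall t \near (0 : R), U (t *: v + x).
Proof.
move=> oU Ux.
have cl : (t *: v + x) @[t --> (0 : R)] --> 0 *: v + x.
  by apply: cvgD; [apply: cvgZr_tmp; exact: cvg_id|exact: cvg_cst].
by apply: cl; rewrite scale0r add0r; exact: open_nbhs_nbhs.
Qed.

(** The curve t |-> (x + t k v, u (x + t k v)) in the graph has velocity
    (k v, k D_v u), so a suitable [k] gives it the same last coordinate as [w];
    the difference is horizontal, hence tangent to the disk. *)
Lemma transverse_graph (R : realType) (n : nat) (u : 'rV[R]_n -> R) :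
  (forall x, unit_ball R n x -> u x = 0 ->
     exists2 v, derivable u x v & 'D_v u x != 0) ->
  transverse (graph_ball u) (horizontal_disk R n).
Proof.
move=> du p [x Ux px] [p0 Up] w.
have ux0 : u x = 0.
  move: p0; rewrite -px row_mxKr => /matrixP/(_ ord0 ord0).
  by rewrite !mxE eqxx.
have [v dv Dv0] := du x Ux ux0.
pose e : 'rV[R]_(n + 1) := row_mx 0 1%:M.
pose k := rsubmx w ord0 ord0 / 'D_v u x.
pose v1 : 'rV[R]_(n + 1) := row_mx (k *: v) 0 + rsubmx w ord0 ord0 *: e.
exists v1, (w - v1); split; last by rewrite addrC subrK.
- exists (fun t => row_mx (t *: (k *: v) + x) (u (t *: (k *: v) + x))%:M); split.
  + by rewrite scale0r add0r.
  + have := near_line (k *: v) (@open_unit_ball R n) Ux.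
    by apply: filterS => t Ut; exists (t *: (k *: v) + x).
  + rewrite (_ : (fun t : R => _) = (fun t => t *: row_mx (k *: v) 0) +
      (fun t => u ((k * t) *: v + x) *: e) + cst (row_mx x 0)); last first.
      apply/funext => t; rewrite [RHS]/= /e /cst !fctE !scale_row_mx !add_row_mx.
      by rewrite !scaler0 !addr0 add0r scalemx1 scalerA mulrC.
    have dk : is_derive (0 : R) 1 (fun t => k * t) k.
      apply: (is_derive_eq (is_deriveM (is_derive_cst k _ _) (is_derive_id (0 : R) 1))).
      by rewrite scaler0 addr0 [_%:A]mulr1.
    have dg : is_derive (k * 0) 1 (fun s : R => u (s *: v + x)) ('D_v u x).
      by rewrite mulr0; apply: is_derive_line; exact: derivableP.
    have du1 := is_derive_scalel e (is_derive_chain dk dg).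
    have did := is_derive_scalel (row_mx (k *: v) 0 : 'rV[R]_(n + 1))
      (is_derive_id (0 : R) 1).
    apply: (is_derive_eq (is_deriveD (is_deriveD did du1) (is_derive_cst _ _ _))).
    by rewrite addr0 scale1r [_ * k]mulrC divfK.
- exists (fun t => t *: (w - v1) + p); split.
  + by rewrite scale0r add0r.
  + have := near_line (w - v1) (@open_unit_ball R (n + 1)) Up.
    apply: filterS => t Ut; split=> //.
    have v1r : v1 ord0 (rshift n ord0) = rsubmx w ord0 ord0.
      rewrite /v1 /e mxE row_mxEr [X in _ + X]mxE row_mxEr.
      by rewrite [X in X + _]mxE [X in _ * X]mxE eqxx mulr1 add0r.
    have pr : p ord0 (rshift n ord0) = 0.
      by move/matrixP: p0 => /(_ ord0 ord0); rewrite !mxE.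
    apply/matrixP => i j; rewrite !ord1 mxE mxE pr addr0 mxE mxE [X in _ + X]mxE v1r.
    by rewrite [X in _ - X]mxE subrr mulr0 mxE.
  + have did := is_derive_scalel (w - v1) (is_derive_id (0 : R) 1).
    apply: (is_derive_eq (is_deriveD did (is_derive_cst p _ _))).
    by rewrite addr0 scale1r.
Qed.

(** At a zero, sin X + Q = sinh Y together with Q^2 = sinh^2 Y + sin^2 X forces
    sin X = 0, so cos X, which is Q times the derivative in the first coordinate,
    does not vanish. *)
Lemma scherk_transverse (R : realType) (m : nat) (l : R) :
  (0 < m)%N -> 0 < l ->
  transverse (graph_ball (@scherk R m l)) (horizontal_disk R m.+1).
Proof.
move=> m0 l0; apply: transverse_graph => x Ux ux0.
have Y0 := scherkY_gt0 l0 Ux.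
have [dx Dx] := is_derive_scherk (delta_mx ord0 ord0) Y0.
exists (delta_mx ord0 ord0) => //.
have neq := ord_max_neq0 m0.
have Q0 := scherkQ_gt0 Y0; have S0 := sinh_gt0 Y0; have sQ0 := sinX_addQ_gt0 Y0.
rewrite Dx !mxE !eqxx neq /= !mulr0 subr0 mulr1.
suff c0 : cos (scherkX l x) != 0.
  by rewrite !(mulf_neq0, invr_neq0) ?(lt0r_neq0 l0) ?(lt0r_neq0 Q0).
have : ln (sin (scherkX l x) + scherkQ l x) = ln (sinh (scherkY l x)).
  by apply/subr0_eq/(mulfI (lt0r_neq0 (_ : 0 < l^-1))); rewrite ?mulr0 ?invr_gt0.
move/(ln_inj sQ0 S0) => sQS.
have s0 : sin (scherkX l x) = 0.
  have sS0 : sin (scherkX l x) * sinh (scherkY l x) = 0.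
    by have := scherkQ2 Y0; have -> : scherkQ l x = sinh (scherkY l x) -
      sin (scherkX l x) by [rewrite -sQS addrAC subrr add0r]; nra.
  by move/eqP: sS0; rewrite mulf_eq0 (gt_eqF S0) orbF => /eqP.
have [c0|//] := eqVneq (cos (scherkX l x)) 0.
have := cos2Dsin2 (scherkX l x); rewrite c0 s0 expr0n addr0 => /eqP.
by rewrite eq_sym oner_eq0.
Qed.

(** * Counting grid points *)

Lemma card_ord_window (N q : nat) (f0 : 'I_N) :
  (#|[pred f : 'I_N | (f <= f0 + q)%N && (f0 <= f + q)%N]| <= (2 * q).+1)%N.
Proof.
pose g (f : 'I_N) : 'I_(2 * q).+1 := inord (f + q - f0).
rewrite -(card_in_image (f := g)).
  by rewrite -[X in (_ <= X)%N]card_ord; exact: max_card.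
move=> f f' /andP[f1 f2] /andP[f1' f2'] /(congr1 val) /=.
by rewrite !inordK; first (by move=> ?; apply: val_inj => /=; lia); lia.
Qed.

Lemma card_ffun_window (m N q : nat) (f0 : {ffun 'I_m -> 'I_N}) :
  (#|[pred f : {ffun 'I_m -> 'I_N} |
      [forall i, (f i <= f0 i + q)%N && (f0 i <= f i + q)%N]]| <= (2 * q).+1 ^ m)%N.
Proof.
pose W (i : 'I_m) := [pred t : 'I_N | (t <= f0 i + q)%N && (f0 i <= t + q)%N].
have -> : #|[pred f : {ffun 'I_m -> 'I_N} |
    [forall i, (f i <= f0 i + q)%N && (f0 i <= f i + q)%N]]| = #|family W|.
  by apply: eq_card => f; rewrite !inE.
rewrite card_family /image_mem foldrE big_map big_enum /=.
rewrite -[X in (_ <= _ ^ X)%N]card_ord -prod_nat_const.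
by apply: leq_prod => i _; exact: card_ord_window.
Qed.

(** K parallel slices orthogonal to the first axis, at distance a / K from each
    other; each carries a grid of N^m points with mesh a / N. *)
Definition slice_grid (R : realType) (m K N : nat) (a : R) (j : 'I_K)
    (f : {ffun 'I_m -> 'I_N}) : 'rV[R]_m.+1 :=
  \row_i if unlift ord0 i is Some i' then a * (f i')%:R / N%:R else a * j%:R / K%:R.

(** Two grid points in a common ball have the same first coordinate, as the
    slices are farther apart than the diameter, and each of their other indices
    differs by less than 2 r N / a. *)
Lemma card_grid_ball (R : realType) (m K N : nat) (a r : R) (y : 'rV[R]_m.+1) :
  (0 < K)%N -> (0 < N)%N -> 0 < a -> 0 <= r -> 2 * r < a / K%:R ->
  (#|[pred t : 'I_K * {ffun 'I_m -> 'I_N} | `|slice_grid a t.1 t.2 - y| < r]|)%:R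
    <= (4 * r * N%:R / a + 1) ^+ m.
Proof.
move=> K0 N0 a0 r0 rK; set B := [pred t | _].
have KR : 0 < K%:R :> R by rewrite ltr0n.
have NR : 0 < N%:R :> R by rewrite ltr0n.
case: (pickP B) => [[j0 f0] Bt0|B0]; last first.
  by rewrite eq_card0 // exprn_ge0 // addr_ge0 // !(mulr_ge0, invr_ge0) // ltW.
have close (t t' : 'I_K * {ffun 'I_m -> 'I_N}) i : t \in B -> t' \in B ->
    `|slice_grid a t.1 t.2 ord0 i - slice_grid a t'.1 t'.2 ord0 i| < 2 * r.
  have coord (x : 'rV[R]_m.+1) : `|x ord0 i| <= `|x|.
    rewrite [leRHS]/Num.norm /= mx_normrE; apply/bigmax_geP; right => /=.
    by exists (ord0, i).
  move=> Bt Bt'; apply: (@le_lt_trans _ _ `|slice_grid a t.1 t.2 - slice_grid a t'.1 t'.2|).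
    by have := coord (slice_grid a t.1 t.2 - slice_grid a t'.1 t'.2); rewrite !mxE.
  apply: (le_lt_trans (ler_distD y _ _)).
  by rewrite (mulr_natl r 2) mulr2n ltrD // distrC.
have cell (n : nat) (s b c : R) : (0 < n)%N ->
    `|a * b / n%:R - a * c / n%:R| < s -> b < c + s * n%:R / a.
  move=> n0; rewrite -mulrBl -mulrBr => /(le_lt_trans (ler_norm _)).
  by rewrite ltr_pdivrMr ?ltr0n // [a * _]mulrC -ltr_pdivlMr // ltrBlDl.
pose q := Num.truncn (2 * r * N%:R / a).
have q0 : 0 <= 2 * r * N%:R / a by rewrite !(mulr_ge0, invr_ge0) // ltW.
have qle : q%:R <= 2 * r * N%:R / a by have /andP[] := truncn_itv q0.
pose W := [pred f : {ffun 'I_m -> 'I_N} |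
      [forall i, (f i <= f0 i + q)%N && (f0 i <= f i + q)%N]].
have BW : {subset B <= [predX pred1 j0 & W]}.
  move=> [j f] Bt; apply/andP; split => /=.
    have := close _ _ ord0 Bt Bt0; rewrite !mxE unlift_none /= => jj.
    have gap : 2 * r * K%:R / a < 1.
      by rewrite ltr_pdivrMr // mul1r -ltr_pdivlMr.
    have lt1 : (j < j0 + 1)%N.
      by rewrite -(ltr_nat R) natrD; have := cell _ _ _ _ K0 jj; lra.
    have lt2 : (j0 < j + 1)%N.
      rewrite distrC in jj.
      by rewrite -(ltr_nat R) natrD; have := cell _ _ _ _ K0 jj; lra.
    by apply/eqP/val_inj => /=; lia.
  apply/forallP => i; have := close _ _ (lift ord0 i) Bt Bt0.
  rewrite !mxE liftK /= => ff.
  have /andP[_ qlt] := truncn_itv q0.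
  have lt1 : (f i < f0 i + q.+1)%N.
    by rewrite -(ltr_nat R) natrD; have := cell _ _ _ _ N0 ff; rewrite -/q in qlt; lra.
  have lt2 : (f0 i < f i + q.+1)%N.
    rewrite distrC in ff.
    by rewrite -(ltr_nat R) natrD; have := cell _ _ _ _ N0 ff; rewrite -/q in qlt; lra.
  by move: lt1 lt2; rewrite !addnS !ltnS => -> ->.
have : (#|B| <= (2 * q).+1 ^ m)%N.
  apply: (@leq_trans #|[predX pred1 j0 & W]|); first exact/subset_leq_card/fintype.subsetP.
  by rewrite cardX card1 mul1n; exact: card_ffun_window.
rewrite -(ler_nat R) => /le_trans; apply.
rewrite natrX; apply: lerXn2r; rewrite ?nnegrE //.
  by rewrite addr_ge0 // !(mulr_ge0, invr_ge0) // ltW.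
rewrite -natr1 lerD2r natrM.
have -> : 4 * r * N%:R / a = 2 * (2 * r * N%:R / a) by ring.
by rewrite ler_pM2l.
Qed.

Lemma grid_cover_count (R : realType) (m K N M : nat) (a : R) (P : pred nat)
    (y : nat -> 'rV[R]_m.+1) (r : nat -> R) :
  (0 < K)%N -> (0 < N)%N -> 0 < a ->
  (forall k, P k -> 0 <= r k /\ 2 * r k < a / K%:R) ->
  (forall (j : 'I_K) (f : {ffun 'I_m -> 'I_N}),
     exists k, [/\ (k < M)%N, P k & `|slice_grid a j f - y k| < r k]) ->
  K%:R * N%:R ^+ m <= \sum_(0 <= k < M | P k) (4 * r k * N%:R / a + 1) ^+ m.
Proof.
move=> K0 N0 a0 rP cov.
pose B k := [pred t : 'I_K * {ffun 'I_m -> 'I_N} | `|slice_grid a t.1 t.2 - y k| < r k].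
apply: (@le_trans _ _ (\sum_(0 <= k < M | P k) #|B k|%:R)); last first.
  by apply: ler_sum => k /rP[r0 rK]; exact: card_grid_ball.
rewrite -natrX -natrM -natr_sum ler_nat.
have -> : (K * N ^ m)%N = #|{: 'I_K * {ffun 'I_m -> 'I_N}}|.
  by rewrite card_prod card_ffun !card_ord.
rewrite -sum1_card (eq_bigr (fun k => \sum_t (t \in B k))%N); last first.
  by move=> k _; rewrite -sum1_card big_mkcond; apply: eq_bigr => t _; case: (t \in B k).
rewrite exchange_big /=; apply: leq_sum => -[j f] _.
have [k [kM Pk Bk]] := cov j f.
rewrite big_mkcond (bigD1_seq k) ?mem_index_iota ?iota_uniq //= Pk.
by rewrite (_ : (j, f) \in B k) // addnC addn1.
Qed.

Lemma exprD3_le (R : realType) (m : nat) (x y z : R) :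
  0 <= x -> 0 <= y -> 0 <= z ->
  (x + y + z) ^+ m <= 3 ^+ m * (x ^+ m + y ^+ m + z ^+ m).
Proof.
move=> x0 y0 z0; pose M := Num.max x (Num.max y z).
have M0 : 0 <= M by rewrite le_max x0.
have xM : x <= M by rewrite le_max lexx.
have yM : y <= M by rewrite !le_max lexx orbT.
have zM : z <= M by rewrite !le_max lexx !orbT.
apply: (@le_trans _ _ ((3 * M) ^+ m)).
  by apply: lerXn2r; rewrite ?nnegrE ?addr_ge0 ?mulr_ge0 //; lra.
rewrite exprMn ler_pM2l ?exprn_gt0 //.
have [xm ym zm] : [/\ 0 <= x ^+ m, 0 <= y ^+ m & 0 <= z ^+ m] by split; exact: exprn_ge0.
have : [\/ M = x, M = y | M = z].
  by rewrite /M; case: leP => _; [case: leP => _|];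
    [constructor 3|constructor 2|constructor 1].
by case=> ->; lra.
Qed.

Lemma sum_half_pow_le1 (R : realType) (M : nat) (P : pred nat) :
  \sum_(0 <= k < M | P k) (2^-1 : R) ^+ k.+1 <= 1.
Proof.
have : \sum_(0 <= k < M) (2^-1 : R) ^+ k.+1 = 1 - 2^-1 ^+ M.
  elim: M => [|M IH]; first by rewrite big_geq // expr0 subrr.
  by rewrite big_nat_recr //= IH exprS; field.
move=> h; apply: (@le_trans _ _ (\sum_(0 <= k < M) (2^-1 : R) ^+ k.+1)).
  rewrite big_mkcond; apply: ler_sum => k _; case: (P k) => //.
by rewrite h gerBl exprn_ge0.
Qed.

(** * Hausdorff measure of parallel slices *)

Definition slices (R : realType) (m K : nat) (a : R) : set 'rV[R]_m.+1 :=
  [set x | (exists j : 'I_K, x ord0 ord0 = a * j%:R / K%:R) /\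
           forall i, 0 <= x ord0 (lift ord0 i) <= a].
Arguments slices {R} m K a.

Lemma compact_slices (R : realType) (m K : nat) (a : R) : compact (slices m K a).
Proof.
pose A (i : 'I_m.+1) : set R := if i == ord0
  then range (fun j : 'I_K => a * j%:R / K%:R) else `[0, a]%classic.
have -> : slices m K a = [set x : 'rV[R]_m.+1 | forall i, A i (x ord0 i)].
  apply/seteqP; split => x /=.
    move=> [[j xj] xi] i; rewrite /A; case: (unliftP ord0 i) => [i'|] ->.
      by rewrite eq_sym (negbTE (neq_lift _ _)) /= in_itv /=.
    by rewrite eqxx; exists j.
  move=> Ax; split=> [|i].
    by have := Ax ord0; rewrite /A eqxx => -[j _ <-]; exists j.
  have := Ax (lift ord0 i).
  by rewrite /A eq_sym (negbTE (neq_lift _ _)) /= in_itv /=.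
apply: rV_compact => i; rewrite /A; case: ifP => _; last exact: segment_compact.
apply: finite_compact; apply: finite_image; exact: finite_finset.
Qed.

(** The closed balls of radius [d k] are enlarged by summable amounts [eta k] into
    open balls, of which [M] are enough by compactness. Counting grid points
    gives K N^m <= sum_(k < M) (4 (d k + eta k) N / a + 1)^m. The third
    term of each summand, once the sum is split in three, contributes at most M,
    and the choice N = M makes this at most N^m; the second one contributes at
    most N^m by the choice of [eta]. *)
Lemma slices_cover_sum (R : realType) (m K : nat) (a : R) (P : pred nat)
    (y : nat -> 'rV[R]_m.+1) (d : nat -> R) :
  (0 < m)%N -> (0 < K)%N -> 0 < a ->
  (forall k, P k -> 0 <= d k <= a / (8 * K%:R)) ->
  (forall x, slices m K a x -> exists2 k, P k & `|x - y k| <= d k) ->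
  exists M, K%:R <= 3 ^+ m * ((4 / a) ^+ m * \sum_(0 <= k < M | P k) d k ^+ m + 2).
Proof.
move=> m0 K0 a0 dP cov.
have KR : 0 < K%:R :> R by rewrite ltr0n.
have K1 : 1 <= K%:R :> R by rewrite ler1n.
(* The bound a / (8 K), shared with [d], keeps the diameters 2 (d k + eta k) at
   most a / (2 K), below the distance of the slices; it also makes
   4 eta k / a <= 2^-(k+1), with sum at most 1. *)
pose eta k : R := a / (8 * K%:R) * 2^-1 ^+ k.
have eta_gt0 k : 0 < eta k by rewrite mulr_gt0 ?exprn_gt0 // divr_gt0 ?mulr_gt0.
pose B k := ball (y k) (d k + eta k).
have coverB : slices m K a `<=` cover [set` P] B.
  move=> x /cov[k Pk xk]; exists k => //.
  by rewrite /B -ball_normE /= distrC; apply: le_lt_trans xk _; rewrite ltrDl.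
have := @compact_slices R m K a; rewrite compact_cover.
move=> /(_ _ [set` P] B (fun k _ => ball_open _ _) coverB)[D DP covD].
pose M := (\max_(k <- finmap.enum_fset D) k).+1.
exists M; pose N := M.
have N0 : (0 < N)%N by [].
have NR : 0 < N%:R :> R by rewrite ltr0n.
pose r k := d k + eta k.
have eta_le k : eta k <= a / (8 * K%:R).
  rewrite ger_pMr ?divr_gt0 ?mulr_gt0 //; apply: exprn_ile1; rewrite ?invr_ge0 //.
  by rewrite invf_le1 ?ler1n.
have rP k : P k -> 0 <= r k /\ 2 * r k < a / K%:R.
  move=> /dP/andP[d0 dk]; split; first by rewrite addr_ge0 // ltW.
  have : a / (8 * K%:R) = 8^-1 * (a / K%:R) by field; rewrite gt_eqF.
  have := eta_le k; have : 0 < a / K%:R by rewrite divr_gt0.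
  by rewrite /r; lra.
have count : K%:R * N%:R ^+ m <= \sum_(0 <= k < M | P k) (4 * r k * N%:R / a + 1) ^+ m.
  apply: (@grid_cover_count R m K N M a P y) => // j f.
  have Sg : slices m K a (slice_grid a j f).
    split=> [|i]; first by exists j; rewrite mxE unlift_none.
    rewrite mxE liftK; apply/andP; split.
      by rewrite !(mulr_ge0, invr_ge0) // ltW.
    by rewrite ler_pdivrMr // ler_pM2l // ler_nat ltnW.
  have [k Dk Bk] := covD _ Sg; exists k; split.
  - by rewrite ltnS; apply: (leq_bigmax_seq (F := id)).
  - by have := DP k Dk; rewrite inE.
  - by move: Bk; rewrite /B -ball_normE /= distrC.
have Nm : 0 < N%:R ^+ m :> R by rewrite exprn_gt0.
rewrite -(ler_pM2r Nm); apply: le_trans count _.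
apply: (@le_trans _ _ (\sum_(0 <= k < M | P k) 3 ^+ m *
   ((4 / a) ^+ m * d k ^+ m * N%:R ^+ m + 2^-1 ^+ k.+1 * N%:R ^+ m + 1))).
  apply: ler_sum => k Pk; have /andP[d0 dk] := dP k Pk.
  have -> : 4 * r k * N%:R / a + 1 = 4 / a * d k * N%:R + 4 / a * eta k * N%:R + 1.
    by rewrite /r; field; rewrite gt_eqF.
  have aN0 z : 0 <= z -> 0 <= 4 / a * z * N%:R.
    by move=> z0; rewrite !mulr_ge0 // invr_ge0 ltW.
  apply: le_trans (exprD3_le m (aN0 _ d0) (aN0 _ (ltW (eta_gt0 k))) ler01) _.
  have -> : (4 / a * d k * N%:R) ^+ m = (4 / a) ^+ m * d k ^+ m * N%:R ^+ m.
    by rewrite -!exprMn.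
  rewrite ler_pM2l ?exprn_gt0 // expr1n lerD2r lerD2l.
  rewrite [(4 / a * eta k * N%:R) ^+ m]exprMn ler_pM2r //.
  have e1 : 4 / a * eta k <= 2^-1 ^+ k.+1.
    have -> : 4 / a * eta k = 2^-1 ^+ k.+1 / K%:R.
      by rewrite /eta exprS; field; rewrite !gt_eqF.
    by rewrite ler_pdivrMr // ler_peMr // exprn_ge0.
  have e0 : 0 <= 4 / a * eta k by rewrite mulr_ge0 ?divr_ge0 // ltW.
  have e2 : 4 / a * eta k <= 1.
    by apply: le_trans e1 _; apply: exprn_ile1; rewrite ?invr_ge0 // invf_le1 ?ler1n.
  by apply: le_trans e1; rewrite -{1}(prednK m0) exprS ler_piMr // exprn_ile1.
rewrite -big_distrr /= -mulrA ler_pM2l ?exprn_gt0 //.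
rewrite !big_split /= -!big_distrl /= -big_distrr /=.
set c4 := (4 / a) ^+ m; rewrite mulrDl -addrA lerD2l.
have s1 := @sum_half_pow_le1 R M P.
have s2 : \sum_(0 <= k < M | P k) (1 : R) <= N%:R ^+ m.
  apply: (@le_trans _ _ M%:R).
    rewrite big_mkcond -[M in M%:R]subn0 -sumr_const_nat.
    by apply: ler_sum => k _; case: (P k).
  by rewrite -natrX ler_nat -{1}[M]expn1 leq_pexp2l.
have := ler_wpM2r (ltW Nm) s1; lra.
Qed.

Lemma omega_gt0 (R : realType) s : 0 < omega R s.
Proof.
suff : 0 < omega R s /\ 0 < omega R s.+1 by case.
elim: s => [|s [IH0 IH1]]; first by split; rewrite /= ?ltr01 ?ltr0n.
split=> //; rewrite [omega R s.+2]/(2 * pi / s.+2%:R * omega R s).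
by rewrite mulr_gt0 // divr_gt0 // mulr_gt0 // pi_gt0.
Qed.

Lemma le_norm_lsubmx_enorm (R : realType) (n p : nat) (x : 'rV[R]_(n + p)) :
  `|lsubmx x| <= enorm x.
Proof.
rewrite [leLHS]/Num.norm /= mx_normrE; apply: bigmax_le => [|[i j] _ /=].
  exact: sqrtr_ge0.
by rewrite mxE ord1; exact: ler_coord_enorm.
Qed.

(** A cover of [E] by sets of diameter at most a / (8 K) gives, through one chosen
    point in each nonempty set, a cover of the slices by closed balls whose radii
    are the diameters; [slices_cover_sum] then bounds the sum of the
    powers of the diameters from below. The norm on row vectors is the sup norm,
    which the Euclidean norm dominates. *)
Lemma hausdorff_slices_gt (R : realType) (m K : nat) (a c : R)
    (E : set 'rV[R]_(m.+1 + 1)) :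
  (0 < m)%N -> (0 < K)%N -> 0 < a ->
  3 ^+ m * ((4 / a) ^+ m * ((c + 1) * 2 ^+ m / omega R m) + 2) < K%:R ->
  (forall x, slices m K a x -> E (row_mx x 0)) ->
  (c%:E < hausdorff m E)%E.
Proof.
move=> m0 K0 a0 Kbig sE; pose delta := a / (8 * K%:R).
have delta0 : 0 < delta by rewrite divr_gt0 // mulr_gt0 // ltr0n.
have w0 := omega_gt0 R m.
apply: (@lt_le_trans _ _ (c + 1)%:E); first by rewrite lte_fin ltrDl.
apply: (@le_trans _ _ (hausdorff_content m delta E)); last first.
  by apply: ereal_sup_ubound; exists delta.
apply: le_ereal_inf_tmp => _ [U [covU diamU ->]].
pose P : pred nat := fun k => U k != set0.
have /choice[y Uy] : forall k, exists y, P k -> U k y.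
  move=> k; have [U0|/set0P[y Uy]] := eqVneq (U k) set0; last by exists y.
  by exists 0; rewrite /P U0 eqxx.
have diam_ub k x x' : U k x -> U k x' -> ((enorm (x - x'))%:E <= diam (U k))%E.
  by move=> Ux Ux'; apply: ereal_sup_ubound; exists x, x'.
have diam0 k : P k -> (0 <= diam (U k))%E.
  move=> Pk; apply: le_trans (diam_ub k _ _ (Uy k Pk) (Uy k Pk)).
  by rewrite lee_fin sqrtr_ge0.
pose d k := fine (diam (U k)).
have dE k : P k -> diam (U k) = (d k)%:E.
  move=> Pk; rewrite fineK // ge0_fin_numE ?diam0 //.
  by apply: le_lt_trans (diamU k) _; rewrite ltry.
have dP k : P k -> 0 <= d k <= a / (8 * K%:R).
  by move=> Pk; rewrite -!lee_fin -dE // diam0 //= diamU.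
have cov x : slices m K a x -> exists2 k, P k & `|x - lsubmx (y k)| <= d k.
  move=> /sE /covU[k _ Uk]; have Pk : P k by apply/set0P; exists (row_mx x 0).
  exists k => //; rewrite -lee_fin -dE //.
  apply: le_trans (diam_ub k _ _ Uk (Uy k Pk)); rewrite lee_fin.
  apply: le_trans (le_norm_lsubmx_enorm _).
  by rewrite linearB /= row_mxKl.
have [M KM] := slices_cover_sum m0 K0 a0 dP cov.
have sum_big : (c + 1) * 2 ^+ m / omega R m <= \sum_(0 <= k < M | P k) d k ^+ m.
  have := lt_le_trans Kbig KM; rewrite ltr_pM2l ?exprn_gt0 // ltrD2r ltr_pM2l.
    exact: ltW.
  by rewrite exprn_gt0 // divr_gt0.
apply: (@le_trans _ _ (\sum_(0 <= k < M | P k)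
    (omega R m / 2 ^+ m)%:E * diam (U k) ^+ m)%E); last first.
  apply: nneseries_lim_ge => k _ Pk; rewrite dE // -EFin_expe -EFinM lee_fin.
  have /andP[dk _] := dP k Pk.
  by rewrite mulr_ge0 ?exprn_ge0 // divr_ge0 ?exprn_ge0 // ltW.
rewrite (eq_bigr (fun k => (omega R m / 2 ^+ m * d k ^+ m)%:E)); last first.
  by move=> k Pk; rewrite dE // -EFin_expe -EFinM.
rewrite sumEFin lee_fin -big_distrr /=.
rewrite -ler_pdivrMl; last by rewrite divr_gt0 // exprn_gt0.
by rewrite invf_div mulrC mulrA.
Qed.

(** * The zero set of the rescaled Scherk graph *)

(** With n = m + 1, the n coordinates lie in [0, 1/n], so their squares sum to
    at most 1/n. *)
Lemma slices_unit_ball (R : realType) (m K : nat) (x : 'rV[R]_m.+1) :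
  (0 < m)%N -> (0 < K)%N -> slices m K (m.+1%:R^-1) x -> unit_ball R m.+1 x.
Proof.
move=> m0 K0 [[j xj] xi]; set a : R := m.+1%:R^-1 in xj xi.
have a0 : 0 < a by rewrite invr_gt0.
have KR : 0 < K%:R :> R by rewrite ltr0n.
have bound i : 0 <= x ord0 i <= a.
  case: (unliftP ord0 i) => [i'|] -> //; rewrite xj; apply/andP; split.
    by rewrite !mulr_ge0 ?invr_ge0 // ltW.
  by rewrite ler_pdivrMr // ler_pM2l // ler_nat ltnW.
rewrite /unit_ball /= /enorm -[ltRHS]sqrtr1 ltr_sqrt //.
apply: (@le_lt_trans _ _ (\sum_(i < m.+1) a ^+ 2)).
  apply: ler_sum => i _; have /andP[x0 xa] := bound i.
  by apply: lerXn2r; rewrite ?nnegrE // ltW.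
rewrite sumr_const card_ord -mulr_natl expr2 mulrA mulfV ?pnatr_eq0 // mul1r.
by rewrite invf_lt1 // ltr1n.
Qed.

(** With n = m + 1, the factor K n pi sends the first coordinate j / (n K) of a
    slice to j pi. *)
Lemma scherk_slices0 (R : realType) (m K : nat) (x : 'rV[R]_m.+1) :
  (0 < m)%N -> (0 < K)%N -> slices m K (m.+1%:R^-1) x ->
  scherk (K%:R * m.+1%:R * pi) x = 0.
Proof.
move=> m0 K0 Sx; have Ux := slices_unit_ball m0 K0 Sx.
have [[j xj] _] := Sx; set l := _ * _ * pi.
have l0 : 0 < l by rewrite !mulr_gt0 ?ltr0n // pi_gt0.
have S0 := sinh_gt0 (scherkY_gt0 l0 Ux).
have X0 : sin (scherkX l x) = 0.
  have -> : scherkX l x = pi *+ j.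
    rewrite /scherkX xj -mulr_natl /l; field.
    by rewrite nat1r !pnatr_eq0 -lt0n K0.
  by elim: (nat_of_ord j) => [|k IH]; rewrite ?mulr0n ?sin0 // mulrSr sinDpi IH oppr0.
by rewrite /scherk /scherkQ X0 expr0n addr0 add0r sqrtr_sqr gtr0_norm // subrr mulr0.
Qed.

Theorem corollary2 (R : realType) (n : nat) (hn : (2 <= n)%N) (c : R) :
  exists u : 'rV[R]_n -> R,
    [/\ minimal_surface_solution u,
        transverse (graph_ball u) (horizontal_disk R n) &
        (c%:E < hausdorff (n - 1) (graph_ball u `&` horizontal_disk R n))%E].
Proof.
case: n hn => [//|m] m0; pose a : R := m.+1%:R^-1.
have a0 : 0 < a by rewrite invr_gt0.
pose K := (Num.truncn (3 ^+ m * ((4 / a) ^+ m * ((c + 1) * 2 ^+ m / omega R m) + 2))).+1.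
pose l : R := K%:R * m.+1%:R * pi.
have l0 : 0 < l by rewrite !mulr_gt0 ?ltr0n // pi_gt0.
exists (scherk l); split; first exact: scherk_minimal.
  exact: scherk_transverse.
rewrite subn1; apply: (@hausdorff_slices_gt R m K a) => //.
  exact: truncnS_gt.
move=> x Sx; have Ux := slices_unit_ball m0 (ltn0Sn _) Sx.
have u0 := scherk_slices0 m0 (ltn0Sn _) Sx.
split; first by exists x => //; rewrite u0 raddf0.
split; first by rewrite row_mxKr.
rewrite /unit_ball /= /enorm big_split_ord /= big_ord1.
rewrite row_mxEr mxE expr0n addr0 (eq_bigr (fun i => x ord0 i ^+ 2)) //.
by move=> i _; rewrite row_mxEl.
Qed.
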